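(* Let $f:\mathbb{R}\to\mathbb{R}$ be a function which is lower semi-continuous except at a countable number of points, i.e. the set $\{x\in\mathbb{R}: f(x)\neq f_{\ast}(x)\}$ is at most countable. Then $f$ is (Borel) measurable. Likewise, let $g:\mathbb{R}\to\mathbb{R}$ be a function which is upper semi-continuous except at a countable number of points, i.e. the set $\{x\in\mathbb{R}: g(x)\neq g^{\ast}(x)\}$ is at most countable. Then $g$ is (Borel) measurable.
   Context: For a function $f:\mathbb{R}\to\mathbb{R}$ and $x\in\mathbb{R}$, define in $\overline{\mathbb{R}}=[-\infty,+\infty]$ $$f^{\ast}(x)=\lim_{\varepsilon\downarrow 0}\sup\{f(y): y\in\,]x-\varepsilon,x+\varepsilon[\},\qquad f_{\ast}(x)=\lim_{\varepsilon\downarrow 0}\inf\{f(y): y\in\,]x-\varepsilon,x+\varepsilon[\}.$$ The point $y=x$ is included in the supremum and infimum. The notation $]a,b[$ denotes the open interval. The function $f$ is upper semi-continuous at $x$ if $f(x)=f^{\ast}(x)$, and lower semi-continuous at $x$ if $f(x)=f_{\ast}(x)$. *)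

(* Defs.v *)
From mathcomp Require Import all_boot all_order all_algebra.
From mathcomp Require Import all_classical all_reals all_analysis.

Set Implicit Arguments.
Unset Strict Implicit.
Unset Printing Implicit Defensive.

Import Order.TTheory GRing.Theory Num.Theory.
Import numFieldNormedType.Exports.

Local Open Scope classical_set_scope.
Local Open Scope ring_scope.

Definition upper_envelope (R : realType) (f : R -> R) (x : R) : \bar R :=
  lim (ereal_sup [set (f y)%:E | y in `]x - e, x + e[ ] @[e --> 0^'+]).

Definition lower_envelope (R : realType) (f : R -> R) (x : R) : \bar R :=
  lim (ereal_inf [set (f y)%:E | y in `]x - e, x + e[ ] @[e --> 0^'+]).

(* Both envelopes are genuine limits: lim never returns its default value here. *)
Lemma upper_envelope_is_cvg (R : realType) (f : R -> R) (x : R) :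
  cvg (ereal_sup [set (f y)%:E | y in `]x - e, x + e[ ] @[e --> 0^'+]).
Proof.
apply: nondecreasing_at_right_is_cvge; near=> b => u v _ _ uv.
apply: ereal_sup_le; apply: image_subset => y /=.
by rewrite !in_itv/= => /andP[h1 h2]; apply/andP; split;
  [apply: le_lt_trans h1; rewrite lerB | apply: (lt_le_trans h2); rewrite lerD2l].
Unshelve. all: by end_near.
Qed.

Lemma lower_envelope_is_cvg (R : realType) (f : R -> R) (x : R) :
  cvg (ereal_inf [set (f y)%:E | y in `]x - e, x + e[ ] @[e --> 0^'+]).
Proof.
apply: nonincreasing_at_right_is_cvge; near=> b => u v _ _ uv.
apply: ereal_inf_le_tmp; apply: image_subset => y /=.
by rewrite !in_itv/= => /andP[h1 h2]; apply/andP; split;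
  [apply: le_lt_trans h1; rewrite lerB | apply: (lt_le_trans h2); rewrite lerD2l].
Unshelve. all: by end_near.
Qed.

Definition lower_semicontinuous_at (R : realType) (f : R -> R) (x : R) : Prop :=
  (f x)%:E = lower_envelope f x.

Definition upper_semicontinuous_at (R : realType) (f : R -> R) (x : R) : Prop :=
  (f x)%:E = upper_envelope f x.

(* Main.v *)
(** If [f] is lower semi-continuous at [x] and [a < f x], then [a < f] on a
    neighbourhood of [x].  Hence [{a < f}] differs from its interior by a
    countable set of exceptional points, and is Borel; likewise for [{g < a}]
    when [g] is upper semi-continuous. *)
Require Import Defs.
From mathcomp Require Import all_boot all_order all_algebra.
From mathcomp Require Import all_classical all_reals all_analysis.
From mathcomp Require Import measurable_realfun.
Import Order.TTheory GRing.Theory Num.Theory.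
Import numFieldNormedType.Exports.
Local Open Scope classical_set_scope.
Local Open Scope ring_scope.

(** Holds because [A] is the union of an open set and a countable one, both Borel. *)
Lemma measurable_countable_setD_interior (R : realType) (A : set R) :
  countable (A `\` A°) -> measurable A.
Proof.
move=> cA; rewrite -(setDKU (@interior_subset _ A)).
apply: measurableU; first exact: countable_measurable.
by apply: open_measurable; exact: open_interior.
Qed.

Lemma near_itvoo_center {R : realType} (x : R) {e : R} :
  0 < e -> \forall y \near x, y \in `]x - e, x + e[.
Proof. by move=> e0; apply: near_in_itvoo; rewrite in_itv/= ltrBlDr ltrDl e0. Qed.

(** The infima over shrinking intervals tend to [f x], so one of them already exceeds [a]; its
    interval is the neighbourhood. *)
Lemma lower_semicontinuous_near {R : realType} {f : R -> R} {x a : R} :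
  lower_semicontinuous_at f x -> a < f x -> \forall y \near x, a < f y.
Proof.
move=> fx afx; have := @lower_envelope_is_cvg R f x.
(* [cvg] says that the infima tend to their [lim], which [fx] identifies with [f x]. *)
rewrite /lower_semicontinuous_at /lower_envelope in fx; rewrite -fx => fcvg.
have : nbhs (f x)%:E [set z | (a%:E < z)%E].
  by apply: open_nbhs_nbhs; split; [exact: open_ereal_gt_ereal|rewrite /= lte_fin].
move=> /fcvg; rewrite nbhs_filterE => near_inf.
(* A single radius suffices; [0 < e] makes its interval a neighbourhood of [x]. *)
have [e [e0 ainf]] := filter_ex (filterI (nbhs_right_gt (0 : R)) near_inf).
apply: filterS (near_itvoo_center x e0) => y ye.
by rewrite -lte_fin; apply: lt_le_trans ainf _; apply: ereal_inf_lbound; exists y.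
Qed.

(** Dual argument: some supremum over an interval around [x] is already below [a]. *)
Lemma upper_semicontinuous_near {R : realType} {g : R -> R} {x a : R} :
  upper_semicontinuous_at g x -> g x < a -> \forall y \near x, g y < a.
Proof.
move=> gx gxa; have := @upper_envelope_is_cvg R g x.
rewrite /upper_semicontinuous_at /upper_envelope in gx; rewrite -gx => gcvg.
have : nbhs (g x)%:E [set z | (z < a%:E)%E].
  by apply: open_nbhs_nbhs; split; [exact: open_ereal_lt_ereal|rewrite /= lte_fin].
move=> /gcvg; rewrite nbhs_filterE => near_sup.
have [e [e0 supa]] := filter_ex (filterI (nbhs_right_gt (0 : R)) near_sup).
apply: filterS (near_itvoo_center x e0) => y ye.
by rewrite -lte_fin; apply: le_lt_trans supa; apply: ereal_sup_ubound; exists y.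
Qed.

Theorem corollary2 (R : realType) :
  (forall f : R -> R,
     countable [set x : R | ~ lower_semicontinuous_at f x] ->
     measurable_fun [set: R] f) /\
  (forall g : R -> R,
     countable [set x : R | ~ upper_semicontinuous_at g x] ->
     measurable_fun [set: R] g).
Proof.
split=> [f cf|g cg] mT.
(* Open rays []a, +oo[] generate the Borel sets, and their preimages are the sets [{a < f}]. *)
- apply: (measurability _ (RGenOInfty.measurableE R)) => // _ [_ [a ->] <-].
  rewrite setTI; apply: measurable_countable_setD_interior.
  (* A point of [{a < f}] outside its interior must be exceptional, since lower semi-continuity
     there would make it interior. *)
  apply: sub_countable cf; apply: subset_card_le => x /= [afx nint] lscx; apply: nint.
  move: afx; rewrite in_itv/= andbT => /(lower_semicontinuous_near lscx).
  by apply: filterS => y; rewrite /= in_itv/= andbT.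
(* Upper semi-continuity calls for the generating rays []-oo, a[] instead. *)
- apply: (measurability _ (RGenInftyO.measurableE R)) => // _ [_ [a ->] <-].
  rewrite setTI; apply: measurable_countable_setD_interior.
  apply: sub_countable cg; apply: subset_card_le => x /= [gxa nint] uscx; apply: nint.
  move: gxa; rewrite in_itv/= => /(upper_semicontinuous_near uscx).
  by apply: filterS => y; rewrite /= in_itv.
Qed.
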